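(* Let $(S,\circ,BB)$ be an Assembly Space. Then for every object $\mathscr{O}\in S$, \[ \big\lceil \log_2\big(s(\mathscr{O})\big)\big\rceil\;\le\;\ell\big(s(\mathscr{O})\big)\;\le\; a(\mathscr{O}). \]
   Context: Addition chains: for $n\in\mathbb{Z}^+$, an addition chain for $n$ is a sequence of positive integers $(a_0,a_1,\dots,a_r)$ with $a_0=1$, $a_r=n$ and, for each $i\in\{1,\dots,r\}$, $a_i=a_j+a_k$ for some $j,k\in\{0,\dots,i-1\}$. $\ell(n)$ denotes the minimal $r$ (number of additions) over all addition chains for $n$; in particular $\ell(1)=0$, $\ell(7)=4$. A Multi-Magma $(S,\circ)$ is a set $S$ together with a binary operation $\circ:2^S\times 2^S\to 2^S$; for $x,y\in S$, $\{x\}\circ\{y\}\subseteq S$. A subset $BB\subseteq S$ is fixed as the set of Building Blocks. Assembly Addition Chains: for $\mathscr{O}\in S\setminus BB$, an Assembly Addition Chain (AAC) of $\mathscr{O}$ is a finite sequence $(\mathscr{O}_1,\dots,\mathscr{O}_r)$ of elements of $S$ with $\mathscr{O}_r=\mathscr{O}$, $\mathscr{O}_1\in\{\mathscr{B}\}\circ\{\mathscr{B}'\}$ for some $\mathscr{B},\mathscr{B}'\in BB$, and such that for each $\rho\in\{2,\dots,r\}$ there exist $\mathscr{O}_\sigma,\mathscr{O}_\tau\in\{\mathscr{O}_1,\dots,\mathscr{O}_{\rho-1}\}\cup BB$ with $\mathscr{O}_\rho\in\{\mathscr{O}_\sigma\}\circ\{\mathscr{O}_\tau\}$. Its length is $r$.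 $AAC(\mathscr{O})$ denotes the set of all such chains. Assembly Multi-Magma: $(S,\circ,BB)$ is an Assembly Multi-Magma if for every $\mathscr{O}\in S\setminus BB$: (1) there exist $\mathscr{B}_0,\dots,\mathscr{B}_r\in BB$ and an AAC $\Gamma(\mathscr{O})=(\mathscr{O}_1,\dots,\mathscr{O}_r=\mathscr{O})$ with $\mathscr{O}_1\in\{\mathscr{B}_0\}\circ\{\mathscr{B}_1\}$ and $\mathscr{O}_i\in\{\mathscr{O}_{i-1}\}\circ\{\mathscr{B}_i\}$ for $i=2,\dots,r$; (2) any other such chain built in the same way from building blocks $\overline{\mathscr{B}}_0,\dots,\overline{\mathscr{B}}_s$ has $s=r$ and the $\overline{\mathscr{B}}_j$ are a permutation of the $\mathscr{B}_i$. Size: $s(\mathscr{O})=1$ if $\mathscr{O}\in BB$ and $s(\mathscr{O})=r+1$ (with $r$ the length of $\Gamma(\mathscr{O})$) otherwise. Assembly Space: an Assembly Multi-Magma such that whenever $\mathscr{O}\in S\setminus BB$ and $\mathscr{O}\in\{\mathscr{O}_\sigma\}\circ\{\mathscr{O}_\tau\}$, we have $s(\mathscr{O})=s(\mathscr{O}_\sigma)+s(\mathscr{O}_\tau)$. Assembly Index: $a(\mathscr{O})=0$ if $\mathscr{O}\in BB$, and otherwise $a(\mathscr{O})$ is the minimum length of an element of $AAC(\mathscr{O})$. *)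

(* Defs.v *)
From HB Require Import structures.
From mathcomp Require Import all_boot all_order all_algebra.
From mathcomp Require Import all_classical all_reals all_analysis.

Set Implicit Arguments.
Unset Strict Implicit.
Unset Printing Implicit Defensive.

Local Open Scope classical_set_scope.

(* Junk value 0 when P is empty. *)
Definition min_nat (P : set nat) : nat :=
  xget 0 [set n | P n /\ forall m, P m -> n <= m].

(* a = [:: a_0; ...; a_r], so that r = (size a).-1. *)
Definition addition_chain (n : nat) (a : seq nat) : Prop :=
  [/\ 0 < size a,
      forall i, i < size a -> 0 < nth 0 a i,
      nth 0 a 0 = 1,
      nth 0 a (size a).-1 = n &
      forall i, 0 < i < size a ->
        exists j k, [/\ j < i, k < i & nth 0 a i = nth 0 a j + nth 0 a k]].

(* Only meaningful for n > 0: there is no addition chain for 0. *)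
Definition ell (n : nat) : nat :=
  min_nat [set r | exists2 a, addition_chain n a & r = (size a).-1].

(* A multi-magma is a type S with an operation op on subsets of S; BB is the
   set of building blocks. A chain (O_1, ..., O_r) is a sequence G : seq S
   with O_(i+1) = nth O G i; the default value O of nth (the target of the
   chain) is irrelevant, since indices are always kept within bounds. *)

Definition AAC (S : Type) (op : set S -> set S -> set S) (BB : set S) (O : S) :
    set (seq S) :=
  [set G | [/\ 0 < size G,
      nth O G (size G).-1 = O,
      exists B B', [/\ BB B, BB B' & op [set B] [set B'] (nth O G 0)] &
      forall i, 0 < i < size G ->
        exists X Y, [/\ (nth O G @` `I_i `|` BB) X,
                        (nth O G @` `I_i `|` BB) Y &
                        op [set X] [set Y] (nth O G i)]]].

(* G is an assembly addition chain of O that adjoins the building blocks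
   B = [:: B_0; ...; B_r] one at a time. *)
Definition block_chain (S : Type) (op : set S -> set S -> set S) (BB : set S)
    (O : S) (B G : seq S) : Prop :=
  [/\ AAC op BB O G,
      size B = (size G).+1,
      forall i, i < size B -> BB (nth O B i),
      op [set nth O B 0] [set nth O B 1] (nth O G 0) &
      forall i, 0 < i < size G ->
        op [set nth O G i.-1] [set nth O B i.+1] (nth O G i)].

Definition assembly_multi_magma (S : Type) (op : set S -> set S -> set S)
    (BB : set S) : Prop :=
  forall O, ~ BB O ->
    exists B G, block_chain op BB O B G /\
      forall B' G', block_chain op BB O B' G' ->
        size G' = size G /\ perm_eq (B' : seq {classic S}) B.

(* In an assembly multi-magma all block chains of O have the same length, so
   the choice made by xget does not matter. *)
Definition obj_size (S : Type) (op : set S -> set S -> set S) (BB : set S)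
    (O : S) : nat :=
  if `[< BB O >] then 1
  else (xget 0 [set r | exists B G, block_chain op BB O B G /\ r = size G]).+1.

Definition assembly_space (S : Type) (op : set S -> set S -> set S)
    (BB : set S) : Prop :=
  assembly_multi_magma op BB /\
  forall O X Y, ~ BB O -> op [set X] [set Y] O ->
    obj_size op BB O = obj_size op BB X + obj_size op BB Y.

Definition assembly_index (S : Type) (op : set S -> set S -> set S)
    (BB : set S) (O : S) : nat :=
  if `[< BB O >] then 0
  else min_nat [set r | exists2 G, AAC op BB O G & r = size G].

(* Main.v *)
Require Import Defs.
From HB Require Import structures.
From mathcomp Require Import all_boot all_order all_algebra.
From mathcomp Require Import all_classical all_reals all_analysis.
From mathcomp Require Import zify.

(** Building blocks have size 1 and sizes add up along an assembly step, so the
    sizes along an assembly addition chain of [O] form, together with 1, an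
    addition chain reaching the size of [O]: the second inequality. Entries of
    the assembly chain that are building blocks contribute nothing new, since
    they have size 1. The first inequality holds because the [i]-th entry of an
    addition chain is at most [2 ^ i]. *)

Set Implicit Arguments.
Unset Strict Implicit.
Unset Printing Implicit Defensive.

Import Order.TTheory GRing.Theory Num.Theory.
Local Open Scope classical_set_scope.

Lemma min_natP (P : set nat) n :
  P n -> P (min_nat P) /\ forall m, P m -> min_nat P <= m.
Proof.
move=> Pn; apply: (@xgetPex _ 0 [set n | P n /\ forall m, P m -> n <= m]).
have exP : exists m, `[< P m >] by exists n; apply/asboolP.
case: (ex_minnP exP) => m /asboolP Pm le_m.
by exists m; split=> // k Pk; apply/le_m/asboolP.
Qed.

Lemma ell_le n a : addition_chain n a -> ell n <= (size a).-1.
Proof.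
move=> ac; have := @min_natP [set r | exists2 b, addition_chain n b &
  r = (size b).-1] (size a).-1.
by case=> [|_]; [exists a | apply; exists a].
Qed.

(** Each entry is its predecessor plus the entry 1 at index 0. This chain shows that [ell] of a
    positive number is a genuine minimum and not the junk value of [min_nat]. *)
Lemma addition_chain_iota n : addition_chain n.+1 (iota 1 n.+1).
Proof.
split; rewrite ?size_iota //.
- by move=> i lti; rewrite nth_iota.
- by rewrite nth_iota.
- move=> i /andP[i0 lti]; exists i.-1, 0; split; [lia | lia |].
  by rewrite !nth_iota //; lia.
Qed.

Lemma ell_attained n : 0 < n ->
  exists2 a, addition_chain n a & ell n = (size a).-1.
Proof.
case: n => // n _.
have [] // := @min_natP [set r | exists2 b, addition_chain n.+1 b &
  r = (size b).-1] (size (iota 1 n.+1)).-1.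
by exists (iota 1 n.+1) => //; exact: addition_chain_iota.
Qed.

Lemma addition_chain_le_exp2 n a : addition_chain n a -> n <= 2 ^ (size a).-1.
Proof.
case=> a0 _ nth0 <- step.
suff le_exp i : i < size a -> nth 0 a i <= 2 ^ i by apply: le_exp; lia.
elim/ltn_ind: i => -[|i] IH lti; first by rewrite nth0.
have [j [k [ltj ltk ->]]] := step i.+1 lti.
(* Both summands sit at indices at most [i], so each is bounded by [2 ^ i]. *)
rewrite expnS mul2n -addnn leq_add //.
- by rewrite (leq_trans (IH j ltj (ltn_trans ltj lti))) // leq_exp2l.
- by rewrite (leq_trans (IH k ltk (ltn_trans ltk lti))) // leq_exp2l.
Qed.

Lemma addition_chain_rcons n a x y : addition_chain n a ->
  x \in a -> y \in a -> addition_chain (x + y) (rcons a (x + y)).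
Proof.
case=> a0 pos nth0 _ step xa ya.
have lex : index x a < size a by rewrite index_mem.
have ley : index y a < size a by rewrite index_mem.
split; rewrite ?size_rcons //=.
- move=> i; rewrite ltnS leq_eqVlt nth_rcons => /predU1P[->|lti].
    by rewrite ltnn eqxx addn_gt0 -(nth_index 0 xa) pos.
  by rewrite lti pos.
- by rewrite nth_rcons a0.
- by rewrite nth_rcons ltnn eqxx.
- move=> i /andP[i0]; rewrite ltnS leq_eqVlt => /predU1P[->|lti].
    exists (index x a), (index y a); split=> //.
    by rewrite !nth_rcons ltnn eqxx lex ley !nth_index.
  have [|j [k [ltj ltk e]]] := step i; first by rewrite i0.
  exists j, k; split=> //.
  by rewrite !nth_rcons lti (ltn_trans ltj lti) (ltn_trans ltk lti).
Qed.

(** Entries only refer to earlier entries, so any nonempty prefix is again a chain. Hence membership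
    in a chain suffices to bound [ell], and the chain's endpoint can be ignored. *)
Lemma addition_chain_take n m a : addition_chain n a -> m \in a ->
  addition_chain m (take (index m a).+1 a).
Proof.
case=> a0 pos nth0 _ step ma.
have lem : index m a < size a by rewrite index_mem.
have sz : size (take (index m a).+1 a) = (index m a).+1 by rewrite size_takel.
split; rewrite ?sz //.
- by move=> i lti; rewrite nth_take // pos // (leq_trans lti).
- by rewrite nth_take.
- by rewrite nth_take // nth_index.
- move=> i /andP[i0 lti].
  have [|j [k [ltj ltk e]]] := step i; first by rewrite i0 (leq_trans lti).
  exists j, k; split=> //.
  by rewrite !nth_take // (ltn_trans _ lti).
Qed.

Lemma ell_le_mem n m a : addition_chain n a -> m \in a -> ell m <= (size a).-1.
Proof.
move=> ac ma; apply: leq_trans (ell_le (addition_chain_take ac ma)) _.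
by rewrite size_takel ?index_mem //= -ltnS prednK ?index_mem //; case: ac.
Qed.

Section Assembly.
Variables (S : Type) (op : set S -> set S -> set S) (BB : set S).

Lemma obj_size_block O : BB O -> obj_size op BB O = 1.
Proof. by move=> bO; rewrite /obj_size asboolT. Qed.

Lemma obj_size_gt0 O : 0 < obj_size op BB O.
Proof. by rewrite /obj_size; case: ifP. Qed.

(** The block chain provided by the multi-magma axiom is itself an assembly addition chain, so the
    minimum is taken over a nonempty set. *)
Lemma assembly_index_attained O : assembly_multi_magma op BB -> ~ BB O ->
  exists2 G, AAC op BB O G & assembly_index op BB O = size G.
Proof.
move=> hS nbO; rewrite /assembly_index asboolF //.
have [B [G [[aG _ _ _ _] _]]] := hS O nbO.
have [] // := @min_natP [set r | exists2 G, AAC op BB O G & r = size G] (size G).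
by exists G.
Qed.

(** Induction on the prefix length [k]. An entry that is a building block leaves the addition chain
    unchanged, so indices of the two chains may drift apart; the invariant therefore records
    membership, an upper bound on the length and an unspecified endpoint [n]. *)
Lemma AAC_addition_chain O G : assembly_space op BB -> AAC op BB O G ->
  forall k, k <= size G -> exists n a,
    [/\ addition_chain n a, (size a).-1 <= k &
        forall i, i < k -> obj_size op BB (nth O G i) \in a].
Proof.
move=> [_ hadd] [G0 _ [B [B' [bB bB' opB]]] step].
elim=> [|k IH] ltk; first by exists 1, [:: 1]; split=> //; exact: (addition_chain_iota 0).
have [n [a [ac sza mema]]] := IH (ltnW ltk).
have [a0 _ nth0 _ _] := ac.
have mem1 : 1 \in a by rewrite -nth0 mem_nth.
have memX X : (nth O G @` `I_k `|` BB) X -> obj_size op BB X \in a.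
  by case=> [[i /= lti <-]|/obj_size_block ->//]; exact: mema.
have [X [Y [hX hY opXY]]] : exists X Y, [/\ (nth O G @` `I_k `|` BB) X,
    (nth O G @` `I_k `|` BB) Y & op [set X] [set Y] (nth O G k)].
  (* The first entry has its own clause in [AAC]: it is composed of two building blocks. *)
  case: k ltk {IH sza mema memX} => [_|k ltk]; last by apply: step; rewrite ltk.
  by exists B, B'; split=> //; right.
(* Additivity of sizes is available only for objects outside [BB]. *)
have [bk|nbk] := pselect (BB (nth O G k)).
  exists n, a; split=> //; first exact: leqW.
  move=> i; rewrite ltnS leq_eqVlt => /predU1P[->|]; last exact: mema.
  by rewrite obj_size_block.
exists (obj_size op BB X + obj_size op BB Y),
  (rcons a (obj_size op BB X + obj_size op BB Y)); split.
- exact: addition_chain_rcons ac (memX X hX) (memX Y hY).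
- by rewrite size_rcons /=; lia.
- move=> i; rewrite ltnS leq_eqVlt mem_rcons in_cons => /predU1P[->|lti].
    by rewrite (hadd _ _ _ nbk opXY) eqxx.
  by rewrite mema // orbT.
Qed.

Lemma ell_le_assembly_index O : assembly_space op BB ->
  ell (obj_size op BB O) <= assembly_index op BB O.
Proof.
move=> hS; have [bO|nbO] := pselect (BB O).
  by rewrite obj_size_block //; exact: leq_trans (ell_le (addition_chain_iota 0)) _.
have [G aG ->] := assembly_index_attained hS.1 nbO.
have [n [a [ac sza mema]]] := AAC_addition_chain hS aG (leqnn _).
apply: leq_trans sza; apply: ell_le_mem ac _.
by case: aG => G0 <- _ _; apply: mema; rewrite prednK.
Qed.

End Assembly.

Lemma ceil_log2_le_ell (R : realType) n : 0 < n ->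
  (Num.ceil (ln n%:R / ln 2 :> R) <= (ell n)%:Z)%R.
Proof.
move=> n0; have [a ac ->] := ell_attained n0.
have ln2 : (0 < ln 2 :> R)%R by rewrite ln_gt0 // ltr1n.
rewrite ceil_le_int ler_pdivrMr //.
(* The cast of [ell n] through the integers is convertible to the direct cast from [nat]; the factor
   then moves inside [ln] as an exponent of 2. *)
rewrite -[X in (_ <= X)%R]/(_%:R * ln 2)%R mulr_natl -lnXn // -natrX.
by rewrite ler_ln ?posrE ?ltr0n ?expn_gt0 // ler_nat addition_chain_le_exp2.
Qed.

Unset Implicit Arguments.

Theorem theorem1 (R : realType) (S : Type) (op : set S -> set S -> set S)
    (BB : set S) (hS : assembly_space op BB) (O : S) :
  (Num.ceil (ln (obj_size op BB O)%:R / ln 2 :> R) <=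
     (ell (obj_size op BB O))%:Z)%R /\
  (ell (obj_size op BB O) <= assembly_index op BB O)%N.
Proof.
split; first exact/ceil_log2_le_ell/obj_size_gt0.
exact: ell_le_assembly_index.
Qed.
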